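(* Let $d\ge 2$ and let $\Omega\subset\mathbb{R}^d$ be compact. Let $X_1,X_2,\ldots$ be i.i.d. points in $\Omega$ with density $\varphi_P$ and $Y_1,Y_2,\ldots$ i.i.d. points in $\Omega$ with density $\varphi_D$, all independent. For each $n$, let $L^*(n)$ be the length of an optimal stacker crane tour through the pairs $(X_i,Y_i)$, $i=1,\ldots,n$, and let $L_{\mathrm{SPLICE}}(n)$ be the length of the stacker crane tour produced by the SPLICE algorithm on these pairs. Then $$\lim_{n\to\infty}\frac{L_{\mathrm{SPLICE}}(n)}{L^*(n)}=1\quad\text{almost surely.}$$
   Context: Given pickup/delivery pairs $(x_i,y_i)$, $i=1,\ldots,n$, a stacker crane tour is a closed tour through all the points $x_1,\ldots,x_n,y_1,\ldots,y_n$ in which each pickup $x_i$ is immediately followed by its delivery $y_i$; its length is the sum of the Euclidean distances along the tour. The SPLICE algorithm: (1) compute a permutation $\sigma$ of $\{1,\ldots,n\}$ minimizing $\sum_i\|x_{\sigma(i)}-y_i\|$ (optimal bipartite matching); (2) add links $x_i\to y_i$ and $y_i\to x_{\sigma(i)}$, forming $N$ disjoint directed subtours; (3) if $N>1$, order the subtours $\mathcal{S}_1,\ldots,\mathcal{S}_N$ arbitrarily, set base = prev = the index of an arbitrary delivery in $\mathcal{S}_1$, and for $k=1,\ldots,N-1$: remove link $y_{\mathrm{prev}}\to x_{\sigma(\mathrm{prev})}$, let next be the index of the pickup in $\mathcal{S}_{k+1}$ closest to $y_{\mathrm{prev}}$, add link $y_{\mathrm{prev}}\to x_{\mathrm{next}}$,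 and set prev $=\sigma^{-1}(\mathrm{next})$; finally add link $y_{\mathrm{prev}}\to x_{\sigma(\mathrm{base})}$. The densities are densities of absolutely continuous distributions. *)

(* Defs.v *)
From HB Require Import structures.
From mathcomp Require Import all_boot all_order all_algebra all_fingroup.
From mathcomp Require Import all_classical all_reals all_analysis.

Set Implicit Arguments.
Unset Strict Implicit.
Unset Printing Implicit Defensive.

Import Order.TTheory GRing.Theory Num.Theory.
Import numFieldNormedType.Exports.
Local Open Scope classical_set_scope.
Local Open Scope ring_scope.

Section Defs.
Variable R : realType.

Definition edist (d : nat) (a b : d.-tuple R) : R :=
  Num.sqrt (\sum_(i < d) (tnth a i - tnth b i) ^+ 2).

(* the corresponding row vector (used to speak of the Euclidean topology) *)
Definition tuple_row (d : nat) (t : d.-tuple R) : 'rV[R]_d :=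
  \row_(i < d) tnth t i.

(* ---------- Stacker crane tours ----------
   For n pairs (x i, y i), i < n, a stacker crane tour is determined by the
   successor map tau on pair indices: the tour is
   x_i -> y_i -> x_(tau i) -> y_(tau i) -> ..., and it is a single closed tour
   iff tau has (at most, for n = 0) one cycle. *)
Definition tour_len (d n : nat) (x y : nat -> d.-tuple R) (tau : {perm 'I_n}) : R :=
  \sum_(i < n) (edist (x i) (y i) + edist (y i) (x (tau i))).

Definition is_tour (n : nat) (tau : {perm 'I_n}) : Prop := (#|porbits tau| <= 1)%N.

Definition is_opt_tour_len (d n : nat) (x y : nat -> d.-tuple R) (L : R) : Prop :=
  (exists tau : {perm 'I_n}, is_tour tau /\ tour_len x y tau = L) /\
  (forall tau : {perm 'I_n}, is_tour tau -> L <= tour_len x y tau).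

Definition match_cost (d n : nat) (x y : nat -> d.-tuple R) (s : {perm 'I_n}) : R :=
  \sum_(i < n) edist (x (s i)) (y i).

Definition opt_matching (d n : nat) (x y : nat -> d.-tuple R) (s : {perm 'I_n}) : Prop :=
  forall s' : {perm 'I_n}, match_cost x y s <= match_cost x y s'.

(* tau is a possible successor map produced by SPLICE (all the arbitrary
   choices of the algorithm -- optimal matching sigma, order of the subtours,
   the base delivery, ties for the closest pickup -- are existentially
   quantified).  Subtours are the cycles (porbit) of sigma.
   base = index of the chosen delivery of S_1;
   nx = [next_1; ...; next_(N-1)], next_k being the chosen pickup of S_(k+1);
   prev_0 = base, prev_k = sigma^-1 next_k. *)
Definition splice_succ (d n : nat) (x y : nat -> d.-tuple R) (tau : {perm 'I_n}) : Prop :=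
  exists sigma : {perm 'I_n}, opt_matching x y sigma /\
  ( ((#|porbits sigma| <= 1)%N /\ tau = sigma) \/
    ((1 < #|porbits sigma|)%N /\
     exists (base : 'I_n) (nx : seq 'I_n),
       let prev := fun k : nat => nth base (base :: map (sigma^-1)%g nx) k in
       size nx = (#|porbits sigma|).-1 /\
       (* S_1 = cycle of base, S_(k+1) = cycle of next_k : all distinct,
          hence an ordering of all N subtours *)
       uniq (map (porbit sigma) (base :: nx)) /\
       (forall k, (k < size nx)%N -> forall j : 'I_n,
          j \in porbit sigma (nth base nx k) ->
          edist (y (prev k)) (x (nth base nx k)) <= edist (y (prev k)) (x j)) /\
       (forall k, (k < size nx)%N -> tau (prev k) = nth base nx k) /\
       tau (prev (size nx)) = sigma base /\
       (forall i : 'I_n, i \notin base :: map (sigma^-1)%g nx -> tau i = sigma i))).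

Definition is_splice_len (d n : nat) (x y : nat -> d.-tuple R) (L : R) : Prop :=
  exists tau : {perm 'I_n}, splice_succ x y tau /\ tour_len x y tau = L.

(* ---------- Lebesgue integral on R^d (iterated, Tonelli) ---------- *)
Fixpoint leb_int (n : nat) : (n.-tuple R -> \bar R) -> \bar R :=
  match n return (n.-tuple R -> \bar R) -> \bar R with
  | 0 => fun f => f [tuple]
  | m.+1 => fun f =>
      (\int[@lebesgue_measure R]_x leb_int (fun t : m.-tuple R => f (cons_tuple x t)))%E
  end.

End Defs.

Section Prob.
Variables (R : realType) (d0 : measure_display) (T : measurableType d0).

Definition has_density (P : probability T R) (dim : nat) (Z : T -> dim.-tuple R)
    (phi : dim.-tuple R -> R) : Prop :=
  measurable_fun setT Z /\ measurable_fun setT phi /\ (forall t, 0 <= phi t) /\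
  forall A : set (dim.-tuple R), measurable A ->
    P (Z @^-1` A) = leb_int (fun t => ((\1_A t : R) * phi t)%:E).

Definition mutually_independent (P : probability T R) (I : eqType) (dim : nat)
    (Z : I -> T -> dim.-tuple R) : Prop :=
  forall (s : seq I) (A : I -> set (dim.-tuple R)),
    uniq s -> (forall i, measurable (A i)) ->
    P (\big[setI/setT]_(i <- s) (Z i @^-1` A i)) =
    (\big[*%E/1%E]_(i <- s) P (Z i @^-1` A i))%E.

End Prob.

(* Main.v *)
Require Import Defs.
From HB Require Import structures.
From mathcomp Require Import all_boot all_order all_algebra all_fingroup.
From mathcomp Require Import all_classical all_reals all_analysis.
From mathcomp Require Import measurable_realfun ring lra zify.

Set Implicit Arguments.
Unset Strict Implicit.
Unset Printing Implicit Defensive.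

Import Order.TTheory GRing.Theory Num.Theory.
Import numFieldNormedType.Exports.
Local Open Scope classical_set_scope.
Local Open Scope ring_scope.

(* Every stacker crane tour costs at least sum_i |x_i - y_i| plus the optimal
   matching cost M.  SPLICE alters at most N links of an optimal matching with
   N cycles, and merging these cycles one by one by transpositions gives a tour
   altering at most 2N links, so |L_SPLICE - L*| <= 2 D N, with D the diameter.

   Ties between two matchings have probability 0: given all the other points,
   a tie forces some y_i onto a branch of hyperboloid with foci x_a <> x_b, which
   is Lebesgue null for d >= 2.  By exchangeability of the x_i each permutation
   is then optimal with probability at most 1/n!.  As the sum over permutations
   of 2^(number of cycles) is (n+1)!, the probability that 2^N >= (n+1)^3 is at
   most 1/(n+1)^2, and Borel-Cantelli gives N = O(sqrt n) almost surely.

   Finally L* grows linearly: for small e the events |x_i - y_i| <= e are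
   independent of probability at most 1/16, so half of the first n of them occur
   with probability at most 2^n 4^-n, and Borel-Cantelli applies again. *)

(* MathComp-Analysis has another [edist]. *)
Local Notation edist := Defs.edist.

(** * Cycles of permutations *)

(** A fixed point forms a cycle of its own, so the transposition joins two different cycles. *)
Lemma porbits_tperm_mul_fixed (T : finType) (s : {perm T}) (x y : T) :
  s x = x -> x != y -> (#|porbits (tperm x y * s)%g|.+1 = #|porbits s|)%N.
Proof.
move=> sx xy; have := porbits_mul_tperm s x y; rewrite /= xy.
suff -> : x \notin porbit s y by rewrite addn2 addn1 => -[].
apply/negP; rewrite porbit_sym => /porbitP[i yi].
have : (s ^+ i)%g x = x.
  by elim: {yi} i => [|i IH]; rewrite ?expg0 ?perm1 // expgS permM sx.
by rewrite -yi => /esym/eqP; rewrite (negbTE xy).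
Qed.

(* Each permutation supported in [A] is [tperm x y * s] for a unique [y \in A]
   and [s] fixing [x]; it has one cycle fewer than [s] unless [y = x]. *)
Lemma sum_exp_porbits_perm_on (T : finType) (A : {set T}) :
  ((\sum_(s : {perm T} | perm_on A s) 2 ^ #|porbits s|) * 2 ^ #|A| <=
   2 ^ #|T| * #|A|.+1`!)%N.
Proof.
move: {2}#|A| (erefl #|A|) => k; elim: k A => [|k IH] A Ak.
  rewrite Ak expn0 muln1 muln1; move/cards0_eq: Ak => ->.
  rewrite (big_pred1 1%g) => [|s]; first by rewrite leq_exp2l// leq_imset_card.
  apply/idP/eqP => [s0|->]; last exact: perm_on1.
  by apply/permP => z; rewrite perm1 (out_perm s0)// inE.
have [x xA] : exists x, x \in A by apply/set0Pn; rewrite -card_gt0 Ak.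
have Ak' : #|A :\ x| = k by move: Ak; rewrite (cardsD1 x) xA add1n => -[].
have {IH} := IH _ Ak'.
rewrite Ak Ak'; set f := (\sum_(s | perm_on (A :\ x) s) _)%N => IH.
have on_inv s : perm_on A s -> (s^-1)%g x \in A.
  by move=> sA; rewrite -(perm_closed _ sA) permKV.
rewrite (partition_big (fun s : {perm T} => (s^-1)%g x) (mem A)) //=.
have onA s y : y \in A -> perm_on A (tperm x y * s)%g ->
    ((tperm x y * s)^-1)%g x == y -> perm_on (A :\ x) s.
  move=> yA sA /eqP e.
  have sx : s x = x.
    by have := congr1 (tperm x y * s)%g e; rewrite permKV permM tpermR.
  apply/fintype.subsetP => z; rewrite !inE => sz; apply/andP; split.
    by apply: contraNneq sz => ->; rewrite sx.
  apply: contraNT sz => zA; have := out_perm sA zA.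
  rewrite permM tpermD; first by move=> ->.
    by apply: contraNneq zA => <-.
  by apply: contraNneq zA => <-.
have bnd y : y \in A -> (\sum_(s | perm_on A s && ((s^-1)%g x == y))
    2 ^ #|porbits s| <= \sum_(s | perm_on (A :\ x) s)
      2 ^ #|porbits (tperm x y * s)%g|)%N.
  move=> yA; rewrite (reindex_inj (mulgI (tperm x y))) /=.
  rewrite big_mkcond [leqRHS]big_mkcond; apply: leq_sum => s _.
  by case: ifPn => // /andP[h1 h2]; rewrite (onA _ _ yA h1 h2).
have fixx s : perm_on (A :\ x) s -> s x = x.
  by move=> h; apply: (out_perm h); rewrite !inE eqxx.
have bnd1 : (\sum_(s | perm_on A s && ((s^-1)%g x == x)) 2 ^ #|porbits s| <= f)%N.
  apply: (leq_trans (bnd _ xA)); apply: eq_leq; apply: eq_bigr => s _.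
  by rewrite tperm1 mul1g.
have bnd2 y : y \in A :\ x ->
    ((\sum_(s | perm_on A s && ((s^-1)%g x == y)) 2 ^ #|porbits s|) * 2 <= f)%N.
  rewrite !inE => /andP[yx yA].
  apply: (@leq_trans ((\sum_(s | perm_on (A :\ x) s)
      2 ^ #|porbits (tperm x y * s)%g|) * 2)); first by rewrite leq_mul2r bnd.
  rewrite big_distrl /=; apply: eq_leq; apply: eq_bigr => s sA.
  by rewrite -expnSr porbits_tperm_mul_fixed ?fixx// eq_sym.
rewrite (bigD1 x) //= expnS.
have : ((\sum_(i in A | i != x) \sum_(s | perm_on A s && ((s^-1)%g x == i))
     2 ^ #|porbits s|) * 2 <= k * f)%N.
  rewrite big_distrl /= -[in leqRHS]Ak' -sum_nat_const.
  rewrite (eq_bigl (mem (A :\ x))) => [|y]; last by rewrite !inE andbC.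
  exact: leq_sum.
(* The choice [y = x] contributes at most [f] and each of the [k] others at most [f / 2], so adding
   [x] to the support multiplies the bound by [(k + 2) / 2]. *)
set g := (\sum_(i in A | _) _)%N; set f1 := (\sum_(s | _) _)%N in bnd1 *.
move=> gk; rewrite factS.
apply: (@leq_trans (k.+2 * (f * 2 ^ k)));
  last by rewrite [leqRHS]mulnCA leq_mul2l IH.
have -> : ((f1 + g) * (2 * 2 ^ k) = (f1 * 2 + g * 2) * 2 ^ k)%N by lia.
by rewrite mulnA leq_mul2r; apply/orP; right; lia.
Qed.

Lemma sum_exp_porbits (n : nat) :
  (\sum_(s : {perm 'I_n}) 2 ^ #|porbits s| <= n.+1`!)%N.
Proof.
have := sum_exp_porbits_perm_on [set: 'I_n]%SET.
rewrite cardsT card_ord mulnC leq_pmul2l ?expn_gt0//.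
rewrite (eq_bigl xpredT)// => s; apply/fintype.subsetP => x; by rewrite inE.
Qed.

(** * Tours and matchings *)

Section Tours.
Context {R : realType} {d n : nat}.
Implicit Types (x y : nat -> d.-tuple R) (s tau : {perm 'I_n}).

Lemma edist_ge0 (a b : d.-tuple R) : 0 <= edist a b.
Proof. exact: sqrtr_ge0. Qed.

Lemma edistC (a b : d.-tuple R) : edist a b = edist b a.
Proof. by congr Num.sqrt; apply: eq_bigr => i _; rewrite -sqrrN opprB. Qed.

Lemma tour_lenE x y tau :
  tour_len x y tau = \sum_(i < n) edist (x i) (y i) + match_cost x y tau.
Proof.
rewrite /tour_len big_split; congr (_ + _).
by apply: eq_bigr => i _; rewrite edistC.
Qed.

Lemma match_cost_ge0 x y tau : 0 <= match_cost x y tau.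
Proof. by apply: sumr_ge0 => i _; exact: edist_ge0. Qed.

Lemma match_cost_le_off x y (D : R) (A : {set 'I_n}) s tau :
    (forall i j : 'I_n, edist (x i) (y j) <= D) ->
    (forall i, i \notin A -> tau i = s i) ->
  match_cost x y tau <= match_cost x y s + D *+ #|A|.
Proof.
move=> xyD tauE; rewrite -sumr_const [X in _ + X]big_mkcond -big_split /=.
apply: ler_sum => i _; case: ifPn => iA; last by rewrite tauE// addr0.
by rewrite (le_trans (xyD _ _))// lerDr edist_ge0.
Qed.

(* Multiplying by a transposition of two points of different cycles merges
   these cycles and changes only two links. *)
Lemma exists_tour_match_cost_le x y (D : R) s : 0 <= D ->
    (forall i j : 'I_n, edist (x i) (y j) <= D) ->
  exists2 tau : {perm 'I_n}, is_tour tau &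
    match_cost x y tau <= match_cost x y s + D *+ (2 * #|porbits s|).
Proof.
move=> D0 xyD; move: {2}#|porbits s| (leqnn #|porbits s|) => k.
elim: k s => [|k IH] s sk.
  exists s; first by rewrite /is_tour (leq_trans sk).
  by rewrite lerDl mulrn_wge0.
have [s1|s1] := leqP #|porbits s| 1.
  by exists s => //; rewrite lerDl mulrn_wge0.
have [_ [_ [/imsetP[a _ ->] /imsetP[b _ ->] ab]]] := card_gt1P s1.
have aNb : a \notin porbit s b by rewrite -eq_porbit_mem.
have neq_ab : a != b by apply: contraNneq ab => ->.
have cs : (#|porbits (tperm a b * s)%g|.+1 = #|porbits s|)%N.
  by have := porbits_mul_tperm s a b; rewrite /= aNb neq_ab addn2 addn1 => -[].
have /IH[tau tau_tour tau_le] : (#|porbits (tperm a b * s)%g| <= k)%N.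
  by rewrite -ltnS cs.
exists tau => //; apply: (le_trans tau_le).
have : match_cost x y (tperm a b * s)%g <=
    match_cost x y s + D *+ #|[set a; b]%SET|.
  apply: match_cost_le_off => // i; rewrite !inE negb_or => /andP[ia ib].
  by rewrite permM tpermD// eq_sym.
rewrite cards2 neq_ab -cs mulnS [D *+ (2 + _)]mulrnDr => h.
by rewrite addrA lerD2r.
Qed.

(** SPLICE redirects only the links leaving the base and the successive [prev] deliveries, which
    makes at most one link per cycle of [s]. *)
Lemma splice_succ_match_cost_le x y (D : R) tau : 0 <= D ->
    (forall i j : 'I_n, edist (x i) (y j) <= D) -> splice_succ x y tau ->
  exists2 s : {perm 'I_n}, opt_matching x y s &
    match_cost x y tau <= match_cost x y s + D *+ #|porbits s|.
Proof.
move=> D0 xyD [s [s_opt H]]; exists s => //.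
case: H => [[_ ->]|[s1 [base [nx [szx [_ [_ [_ [_ tauE]]]]]]]]].
  by rewrite lerDl mulrn_wge0.
pose A := [set i in base :: map (s^-1)%g nx]%SET.
have : match_cost x y tau <= match_cost x y s + D *+ #|A|.
  by apply: match_cost_le_off => // i; rewrite inE => /tauE.
move=> /le_trans; apply; rewrite lerD2l ler_wpMn2l//.
rewrite cardsE (leq_trans (card_size _))//= size_map szx.
by rewrite prednK// ltnW.
Qed.

(** The pickup-to-delivery cost is common to all tours and cancels in [Ls - Lo]. Both tours cost at
    least the matching [s]; the SPLICE tour exceeds it by at most one [D] per cycle, the optimal
    tour by at most two, through the merged tour. *)
Lemma splice_opt_dist x y (D Lo Ls : R) : 0 <= D ->
    (forall i j : 'I_n, edist (x i) (y j) <= D) ->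
    is_opt_tour_len n x y Lo -> is_splice_len n x y Ls ->
  \sum_(i < n) edist (x i) (y i) <= Lo /\
  exists2 s : {perm 'I_n}, opt_matching x y s &
    `|Ls - Lo| <= D *+ (2 * #|porbits s|).
Proof.
move=> D0 xyD [[to [to_tour <-]] Lo_le] [ts [ts_spl <-]]; split.
  by rewrite tour_lenE lerDl match_cost_ge0.
have [s s_opt ts_le] := splice_succ_match_cost_le D0 xyD ts_spl.
have [t t_tour t_le] := exists_tour_match_cost_le s D0 xyD.
exists s => //.
have := Lo_le _ t_tour; rewrite !tour_lenE lerD2l => to_le.
have h1 := s_opt to; have h2 := s_opt ts.
have h3 : D *+ #|porbits s| <= D *+ (2 * #|porbits s|).
  by rewrite ler_wpMn2l// leq_pmull.
by rewrite ler_norml; apply/andP; split; lra.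
Qed.

End Tours.

(** Logarithms are avoided by [q + 1 <= 2 ^ q] with [q = N / 6]: then
    [(q + 1) ^ 6 <= 2 ^ N < (n + 1) ^ 3], and taking cube roots bounds [(q + 1) ^ 2]. *)
Lemma exp2_lt_cube (N n : nat) : (2 ^ N < n.+1 ^ 3)%N -> (N ^ 2 <= 36 * n.+1)%N.
Proof.
move=> h; pose q := (N %/ 6)%N.
have Nq : (N < 6 * q.+1)%N by rewrite /q; lia.
have h6 : (q.+1 ^ 6 <= 2 ^ N)%N.
  apply: (@leq_trans ((2 ^ q) ^ 6)); first by rewrite leq_exp2r// ltn_expl.
  by rewrite -expnM leq_exp2l// /q; lia.
have : (q.+1 ^ 2 < n.+1)%N.
  by rewrite -(ltn_exp2r _ _ (isT : 0 < 3)%N) -expnM (leq_ltn_trans h6).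
nia.
Qed.

(** * Null sets of the iterated Lebesgue integral *)

Section NullSets.
Context {R : realType}.

(* polynomial in each variable separately *)
Fixpoint sep_poly (n : nat) : (n.-tuple R -> R) -> Prop :=
  match n return (n.-tuple R -> R) -> Prop with
  | 0 => fun=> True
  | m.+1 => fun f =>
      (forall t : m.-tuple R, exists p : {poly R},
         forall u, f (cons_tuple u t) = p.[u]) /\
      (forall u, sep_poly (fun t : m.-tuple R => f (cons_tuple u t)))
  end.

Lemma sep_polyC n (c : R) : sep_poly (fun _ : n.-tuple R => c).
Proof.
by elim: n => [//|n IH]; split=> // t; exists c%:P => u; rewrite hornerC.
Qed.

Lemma sep_polyD n (f g : n.-tuple R -> R) :
  sep_poly f -> sep_poly g -> sep_poly (fun t => f t + g t).
Proof.
elim: n f g => [//|n IH] f g [f1 f2] [g1 g2]; split=> [t|u].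
  2: exact: (IH _ _ (f2 u) (g2 u)).
have [p fp] := f1 t; have [q gq] := g1 t; exists (p + q) => u.
by rewrite hornerD fp gq.
Qed.

Lemma sep_polyM n (f g : n.-tuple R -> R) :
  sep_poly f -> sep_poly g -> sep_poly (fun t => f t * g t).
Proof.
elim: n f g => [//|n IH] f g [f1 f2] [g1 g2]; split=> [t|u].
  2: exact: (IH _ _ (f2 u) (g2 u)).
have [p fp] := f1 t; have [q gq] := g1 t; exists (p * q) => u.
by rewrite hornerM fp gq.
Qed.

Lemma sep_poly_tnth n (i : 'I_n) : sep_poly (fun t => tnth t i).
Proof.
elim: n i => [|n IH] i; first by case: i.
case: (unliftP ord0 i) => [j ->|->]; split=> [t|u].
- by exists (tnth t j)%:P => u; rewrite hornerC tnthS.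
- rewrite (_ : (fun _ => _) = (fun t => tnth t j)); first exact: IH.
  by apply/funext => t; rewrite tnthS.
- by exists 'X => u; rewrite hornerX.
- exact: sep_polyC.
Qed.

Lemma sep_polyB n (f g : n.-tuple R -> R) :
  sep_poly f -> sep_poly g -> sep_poly (fun t => f t - g t).
Proof.
move=> hf hg; apply: sep_polyD => //.
rewrite (_ : (fun _ => _) = (fun t => -1 * g t)).
  by apply: sep_polyM => //; exact: sep_polyC.
by apply/funext => t; rewrite mulN1r.
Qed.

Lemma sep_polyX n (f : n.-tuple R -> R) k :
  sep_poly f -> sep_poly (fun t => f t ^+ k).
Proof.
move=> hf; elim: k => [|k IH]; first exact: sep_polyC.
rewrite (_ : (fun _ => _) = (fun t => f t * f t ^+ k)); first exact: sep_polyM.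
by apply/funext => t; rewrite exprS.
Qed.

Lemma sep_poly_sum n (I : Type) (r : seq I) (f : I -> n.-tuple R -> R) :
  (forall i, sep_poly (f i)) -> sep_poly (fun t => \sum_(i <- r) f i t).
Proof.
move=> hf; elim: r => [|i r IH].
  rewrite (_ : (fun _ => _) = (fun=> 0)); first exact: sep_polyC.
  by apply/funext => t; rewrite big_nil.
rewrite (_ : (fun _ => _) = (fun t => f i t + \sum_(i <- r) f i t)).
  exact: sep_polyD.
by apply/funext => t; rewrite big_cons.
Qed.

Local Open Scope ereal_scope.

(** Measurability of [g] is derived from the finite support, so that the lemma applies at every
    level of the iterated integral. *)
Lemma integral_finite_support (F : set R) (g : R -> \bar R) :
  finite_set F -> (forall x, 0 <= g x) -> (forall x, ~ F x -> g x = 0) ->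
  \int[@lebesgue_measure R]_x g x = 0.
Proof.
move=> finF g0 gF.
have ctF : countable F by exact: finite_set_countable.
have mF : measurable F by apply: countable_measurable.
have mg : measurable_fun setT g.
  move=> _ B mB; rewrite setTI.
  have mFB : measurable (g @^-1` B `&` F).
    by apply: countable_measurable => //; apply: sub_countable ctF;
       apply: subset_card_le => x [].
  have [B0|B0] := pselect (B 0).
    rewrite (_ : _ @^-1` _ = (g @^-1` B `&` F) `|` ~` F).
      by apply: measurableU => //; exact: measurableC.
    apply/seteqP; split=> x /=; last by case=> [[]//|/gF ->].
    by move=> Bx; have [Fx|nFx] := pselect (F x); [left|right].
  rewrite (_ : _ @^-1` _ = g @^-1` B `&` F)//.
  apply/seteqP; split=> x /=; last by case.
  by move=> Bx; split=> //; apply: contrapT => /gF gx; rewrite gx in Bx.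
rewrite (@ge0_negligible_integral _ _ _ lebesgue_measure setT F)//; last first.
  exact: countable_lebesgue_measure0.
by apply: integral0_eq => x [_ /gF].
Qed.

Lemma leb_int_ge0 n (g : n.-tuple R -> \bar R) :
  (forall t, 0 <= g t) -> 0 <= leb_int g.
Proof.
elim: n g => [|n IH] g g0 /=; first exact: g0.
by apply: integral_ge0 => x _; exact: IH.
Qed.

(* The restriction of [f] to the line through [t0] in the first direction has
   finitely many roots, and off these [f] is nonzero somewhere on the slice. *)
Lemma leb_int_sep_poly_support n (f : n.-tuple R -> R) (g : n.-tuple R -> \bar R)
    (t0 : n.-tuple R) : sep_poly f -> f t0 != 0%R ->
    (forall t, 0 <= g t) -> (forall t, f t != 0%R -> g t = 0) ->
  leb_int g = 0.
Proof.
elim: n f g t0 => [|n IH] f g t0.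
  by move=> _ f0 _ fg; apply: fg; rewrite (tuple0 t0) in f0.
case: (tupleP t0) => u0 {}t0 [f1 f2] f0 g0 fg /=.
have [p pE] := f1 t0.
have p0 : p != 0%R by apply: contraNneq f0 => p0; rewrite pE p0 horner0.
apply: (@integral_finite_support [set u | root p u]).
- apply: contrapT => /(infinite_set_fset (size p))[B Bp szB].
  have : all (root p) (finmap.enum_fset B) by apply/allP => x /Bp.
  by move=> /(max_poly_roots p0)/(_ (finmap.fset_uniq B)); rewrite ltnNge szB.
- by move=> x; apply: leb_int_ge0.
- move=> u /= /negP pu; apply: (IH (fun t => f (cons_tuple u t)) _ t0) => //.
  + exact: f2.
  + by rewrite pE.
  + by move=> t; exact: fg.
Qed.

(** * Points and branches of hyperboloids are null *)

Section Bisector.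
Variable d : nat.
Implicit Types a b t : d.-tuple R.

Local Open Scope ring_scope.

Let sqd a t : R := \sum_(i < d) (tnth a i - tnth t i) ^+ 2.

Let edist_sqr a t : edist a t ^+ 2 = sqd a t.
Proof. by rewrite sqr_sqrtr// sumr_ge0// => i _; exact: sqr_ge0. Qed.

Let sep_poly_sqd a : sep_poly (sqd a).
Proof.
apply: sep_poly_sum => i; apply: sep_polyX; apply: sep_polyB.
  exact: sep_polyC.
exact: sep_poly_tnth.
Qed.

Let sqd_eq0 a t : sqd a t = 0 -> a = t.
Proof.
move=> /eqP; rewrite psumr_eq0 => [/allP h|i _]; last exact: sqr_ge0.
apply: eq_from_tnth => i; apply/eqP; rewrite -subr_eq0 -sqrf_eq0.
exact: (h i (mem_index_enum _)).
Qed.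

Lemma edist_eq0 a t : edist a t = 0 -> a = t.
Proof. by move=> e; apply: sqd_eq0; rewrite -edist_sqr e expr0n. Qed.

Lemma edistxx a : edist a a = 0.
Proof.
by rewrite /edist big1 ?sqrtr0// => i _; rewrite subrr expr0n.
Qed.

(** A point lies in the zero set of a nonzero affine function of one coordinate. *)
Lemma leb_int_support1 a (g : d.-tuple R -> \bar R) : (0 < d)%N ->
    (forall t, 0 <= g t)%E -> (forall t, t <> a -> g t = 0%E) ->
  leb_int g = 0%E.
Proof.
move=> d0 g0 ga.
pose i0 := Ordinal d0.
apply: (@leb_int_sep_poly_support _ (fun t => tnth t i0 - tnth a i0) _
    [tuple tnth a i + 1 | i < d]) => //.
- by apply: sep_polyB; [exact: sep_poly_tnth|exact: sep_polyC].
- by rewrite tnth_mktuple addrAC subrr add0r oner_neq0.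
- by move=> t ta; apply: ga => e; rewrite e subrr eqxx in ta.
Qed.

(* Squaring twice shows that the branch of hyperboloid
   [|a - t| - |b - t| = c] is contained in the zero set of the polynomial
   [(|a - t|^2 - |b - t|^2 - c^2)^2 - 4 c^2 |b - t|^2].
   If [|a - b| = |c|] the latter is nonzero at [b + v] with [v] orthogonal to
   [a - b], otherwise it is nonzero at [b]. *)
Lemma leb_int_hyperboloid a b (c : R) (g : d.-tuple R -> \bar R) :
    (2 <= d)%N -> a <> b -> (forall t, 0 <= g t)%E ->
    (forall t, edist a t - edist b t <> c -> g t = 0%E) ->
  leb_int g = 0%E.
Proof.
move=> d2 ab g0 gc.
pose f t := (sqd a t - sqd b t - c ^+ 2) ^+ 2 - 4 * c ^+ 2 * sqd b t.
have f_poly : sep_poly f.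
  apply: sep_polyB; [apply: sep_polyX; apply: sep_polyB; first exact: sep_polyB|
    apply: sep_polyM => //]; exact: sep_polyC.
have fg t : f t != 0 -> g t = 0%E.
  move=> ft; apply: gc => e; move/eqP: ft; apply.
  rewrite /f -!edist_sqr -e; ring.
suff [t ft] : exists t, f t != 0.
  exact: (leb_int_sep_poly_support f_poly ft g0 fg).
have bb : sqd b b = 0 by rewrite -edist_sqr edistxx expr0n.
have [abc|abc] := eqVneq (sqd a b) (c ^+ 2); last first.
  by exists b; rewrite /f bb mulr0 !subr0 expf_neq0// subr_eq0.
have ab0 : sqd a b != 0 by apply/eqP => /sqd_eq0.
have [k abk] : exists k, tnth a k != tnth b k.
  apply: contrapT => h; apply: ab; apply: eq_from_tnth => k.
  by apply/eqP; apply: contrapT => /negP hk; apply: h; exists k.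
have [j jk] : exists j : 'I_d, j != k.
  have [k0|k0] := eqVneq k (Ordinal (ltnW d2)).
    by exists (Ordinal d2); rewrite k0.
  by exists (Ordinal (ltnW d2)); rewrite eq_sym.
(* The projection of [a - b] to coordinates [k] and [j], turned by a right angle; its [j]-th
   coordinate is nonzero by the choice of [k]. *)
pose v i : R := if i == k then - (tnth a j - tnth b j)
                else if i == j then tnth a k - tnth b k else 0.
pose t := [tuple tnth b i + v i | i < d].
have sb : sqd b t = \sum_i v i ^+ 2.
  by apply: eq_bigr => i _; rewrite tnth_mktuple opprD addNKr sqrrN.
have uv : \sum_i (tnth a i - tnth b i) * v i = 0.
  rewrite (bigD1 k)//= (bigD1 j)//= big1 => [|i /andP[ik ij]]; last first.
    by rewrite /v (negbTE ik) (negbTE ij) mulr0.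
  by rewrite /v eqxx (negbTE jk) eqxx; ring.
(* Pythagoras. With [sqd a b = c ^+ 2] the squared term of [f] vanishes at [t], leaving only the
   negative term. *)
have sa : sqd a t = sqd a b + sqd b t.
  transitivity (sqd a b + sqd b t - 2 * \sum_i (tnth a i - tnth b i) * v i).
    rewrite sb -big_split/= mulr_sumr -sumrB.
    by apply: eq_bigr => i _; rewrite tnth_mktuple; ring.
  by rewrite uv mulr0 subr0.
exists t; rewrite /f sa -abc.
rewrite (_ : _ - _ = - (4 * sqd a b * sqd b t)); last by ring.
rewrite oppr_eq0 !mulf_neq0//; apply/eqP => e0.
move: e0 => /eqP; rewrite sb psumr_eq0 => [/allP h|i _]; last exact: sqr_ge0.
have := h j (mem_index_enum _).
by rewrite /= /v (negbTE jk) eqxx sqrf_eq0 subr_eq0 (negbTE abk).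
Qed.

End Bisector.

End NullSets.

(** * Independence and laws of families *)

Section Cylinders.
Context {dS : measure_display} {S : measurableType dS} {I : choiceType}.
Context {T : pointedType}.
Implicit Types (Z : I -> T -> S) (s : seq I).

(** The pi-system of rectangles, generating the sigma-algebra of the variables [Z k] with
    [k \in s]. *)
Definition cylinders Z s : set (set T) :=
  [set B | exists2 A : I -> set S, (forall k, measurable (A k)) &
    B = \bigcap_(k in [set` s]) (Z k @^-1` A k)].

Lemma cylindersI Z s : setI_closed (cylinders Z s).
Proof.
move=> _ _ [A mA ->] [B mB ->]; exists (fun k => A k `&` B k).
  by move=> k; exact: measurableI.
by rewrite -bigcapI; apply: eq_bigcapr => k _; rewrite preimage_setI.
Qed.

Lemma cylindersT Z s : cylinders Z s setT.
Proof.
exists (fun=> setT) => //; apply/seteqP; split=> // w _ k _ //.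
Qed.

Lemma measurable_coord Z s k : k \in s ->
  measurable_fun setT (Z k : g_sigma_algebraType (cylinders Z s) -> S).
Proof.
move=> ks _ B mB; rewrite setTI; apply: sub_sigma_algebra.
exists (fun i => if i == k then B else setT) => [i|]; first by case: ifP.
apply/seteqP; split=> [w Bw i _ /=|w /(_ k ks) /=]; last by rewrite eqxx.
by case: eqP => // ->.
Qed.

End Cylinders.

Section Independence.
Context {R : realType} {d0 : measure_display} {T : measurableType d0}.
Variable P : probability T R.
Local Open Scope ereal_scope.

(** The finite measures [A |-> P (A]&[B)] and [A |-> P A * P B] agree on a pi-system, hence on the
    sigma-algebra it generates. *)
Lemma indep_g_sigma (G : set (set T)) (B : set T) :
    G `<=` measurable -> setI_closed G -> G setT -> measurable B ->
    (forall A, G A -> P (A `&` B) = P A * P B) ->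
  forall A, <<s G >> A -> P (A `&` B) = P A * P B.
Proof.
move=> Gm GI GT mB GB A GA.
have PB0 : (0 <= fine (P B))%R by rewrite fine_ge0.
have PBE : (fine (P B))%:E = P B by rewrite fineK// fin_num_measure.
have m12 C : (mrestr P mB C = mscale (NngNum PB0) P C) =
    (P (C `&` B) = P C * P B) by rewrite /mrestr /mscale /= PBE muleC.
rewrite -m12; apply: (g_sigma_algebra_measure_unique G Gm (fun=> setT)) => //=.
- by rewrite bigcup_const.
- by move=> C GC; rewrite m12; exact: GB.
- by move=> _; rewrite /mrestr setTI (le_lt_trans (probability_le1 P mB))// ltry.
Qed.

Context {dS : measure_display} {S : measurableType dS} {I : choiceType}.
Variable Z : I -> T -> S.
Hypothesis mZ : forall k, measurable_fun setT (Z k).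

Lemma cylinders_measurable (s : seq I) : cylinders Z s `<=` measurable.
Proof.
move=> _ [A mA ->]; rewrite bigcap_seq; apply: bigsetI_measurable => k _.
by rewrite -[X in measurable X]setTI; exact: mZ.
Qed.

Lemma sub_cylinders_measurable (s : seq I) :
  <<s cylinders Z s >> `<=` @measurable _ T.
Proof.
apply: smallest_sub; first exact: sigma_algebra_measurable.
exact: cylinders_measurable.
Qed.

Hypothesis indep : forall (s : seq I) (A : I -> set S),
  uniq s -> (forall i, measurable (A i)) ->
  P (\big[setI/setT]_(i <- s) (Z i @^-1` A i)) =
  \big[*%E/1]_(i <- s) P (Z i @^-1` A i).

(** Independence of disjoint blocks: rectangles are extended to the generated sigma-algebra in one
    argument, then in the other. *)
Lemma indep_cylinders (s1 s2 : seq I) (A B : set T) : uniq (s1 ++ s2) ->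
  <<s cylinders Z s1 >> A -> <<s cylinders Z s2 >> B ->
  P (A `&` B) = P A * P B.
Proof.
move=> us hA hB.
apply: (@indep_g_sigma (cylinders Z s1)) => //.
- exact: cylinders_measurable.
- exact: cylindersI.
- exact: cylindersT.
- exact: sub_cylinders_measurable hB.
move=> {hA}A hA; rewrite setIC muleC.
apply: (@indep_g_sigma (cylinders Z s2)) => //.
- exact: cylinders_measurable.
- exact: cylindersI.
- exact: cylindersT.
- exact: cylinders_measurable hA.
move=> {hB}B [C mC ->]; case: hA => D mD ->.
(* One family of sides for both rectangles, well defined because the blocks are disjoint. *)
pose E k := if k \in s2 then C k else D k.
have mE k : measurable (E k) by rewrite /E; case: ifP.
have s12 k : k \in s1 -> (k \in s2) = false.
  move=> ks1; apply/negP => ks2; move: us; rewrite cat_uniq => /and3P[_ /hasP].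
  by move=> []; exists k.
rewrite !bigcap_seq.
have C2 : \big[setI/setT]_(k <- s2) (Z k @^-1` C k) =
    \big[setI/setT]_(k <- s2) (Z k @^-1` E k).
  by rewrite !big_seq; apply: eq_bigr => k ks; rewrite /E ks.
have D1 : \big[setI/setT]_(k <- s1) (Z k @^-1` D k) =
    \big[setI/setT]_(k <- s1) (Z k @^-1` E k).
  by rewrite !big_seq; apply: eq_bigr => k ks; rewrite /E s12.
have := us; rewrite cat_uniq => /and3P[us1 _ us2].
by rewrite C2 D1 setIC -big_cat /= !indep// big_cat /= muleC.
Qed.

(** Fubini: as [Z j] is independent of the variables in [s], the pair [(w, Z j w)] has a product law
    when [w] is seen through their sigma-algebra, and almost sure events can be checked with those
    variables frozen. *)
Lemma indep_section_null (s : seq I) (j : I)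
    (B : set (g_sigma_algebraType (cylinders Z s) * S)) :
    uniq (rcons s j) -> measurable B ->
    (forall w, P (Z j @^-1` xsection B w) = 0) ->
  P.-negligible [set w | B (w, Z j w)].
Proof.
move=> us mB B0.
pose G := g_sigma_algebraType (cylinders Z s).
have mid : measurable_fun setT (id : T -> G).
  by move=> _ A mA; rewrite setTI preimage_id; exact: sub_cylinders_measurable mA.
have mp : measurable_fun setT ((fun w => (w, Z j w)) : T -> (G * S)%type).
  exact: measurable_fun_pair.
have mpB : measurable [set w | B (w, Z j w)].
  by have := mp measurableT _ mB; rewrite setTI.
apply/negligibleP => //.
pose m1 := distribution P (mfun_Sub (mem_set mid)).
pose m2 := distribution P (mfun_Sub (mem_set (mZ j))).
pose m' := distribution P (mfun_Sub (mem_set mp)).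
have /(_ _ mB) : forall X, measurable X -> (m1 \x m2) X = m' X.
  apply: product_measure_unique => A1 A2 mA1 mA2.
  change (P (A1 `&` (Z j @^-1` A2)) = P A1 * P (Z j @^-1` A2)).
  apply: (@indep_cylinders s [:: j]) => //.
    by rewrite cats1.
  have := @measurable_coord _ _ _ _ Z [:: j] j (mem_head _ _) measurableT _ mA2.
  by rewrite setTI.
move=> m12B; change (m' B = 0); rewrite -m12B.
rewrite /product_measure1/= integral0_eq// => w _ /=.
exact: B0.
Qed.

End Independence.

Section Law.
Context {R : realType} {d0 : measure_display} {T : measurableType d0}.
Variable P : probability T R.
Context {dS : measure_display} {S : measurableType dS} {I : choiceType}.
Variables (s : seq I) (Z Z' : I -> T -> S).
Hypotheses (mZ : forall k, measurable_fun setT (Z k))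
  (mZ' : forall k, measurable_fun setT (Z' k)).

(** Evaluation on the path space [I -> S]; its cylinders generate the sigma-algebra on which joint
    laws are compared. *)
Definition coordinate (k : I) (f : I -> S) : S := f k.

Let measurable_path (V : I -> T -> S) :
    (forall k, measurable_fun setT (V k)) ->
  measurable_fun setT ((fun w k => V k w) :
    T -> g_sigma_algebraType (cylinders coordinate s)).
Proof.
move=> mV; apply: (@measurability _ _ _
  (g_sigma_algebraType (cylinders coordinate s)) _ _
  (cylinders coordinate s)) => //.
move=> _ [_ [A mA ->] <-]; rewrite setTI.
by apply: (cylinders_measurable mV); exists A.
Qed.

Lemma eq_law :
    (forall A : I -> set S, (forall k, measurable (A k)) ->
      P (\bigcap_(k in [set` s]) (Z k @^-1` A k)) =
      P (\bigcap_(k in [set` s]) (Z' k @^-1` A k))) ->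
  forall B : set (I -> S), <<s cylinders coordinate s >> B ->
    P ((fun w k => Z k w) @^-1` B) = P ((fun w k => Z' k w) @^-1` B).
Proof.
move=> ZZ' B mB.
pose m1 := distribution P (mfun_Sub (mem_set (measurable_path mZ))).
pose m2 := distribution P (mfun_Sub (mem_set (measurable_path mZ'))).
change (m1 B = m2 B).
apply: (@measure_unique _ R (g_sigma_algebraType (cylinders coordinate s))
  (cylinders coordinate s) (fun=> setT) erefl (@cylindersI _ _ _ _ _ _)
  _ _ m1 m2) => //.
- by move=> _; exact: cylindersT.
- by rewrite bigcup_const.
- by move=> _ [A mA ->]; exact: ZZ'.
- by move=> _; rewrite (le_lt_trans (probability_le1 m1 measurableT))// ltry.
Qed.

End Law.

(** * Measurability of distances and of optimality *)

Section EuclideanMeasurability.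
Context {R : realType} {d : nat} {d0 : measure_display} {T : measurableType d0}.

Lemma measurable_fun_edist (f g : T -> d.-tuple R) :
  measurable_fun setT f -> measurable_fun setT g ->
  measurable_fun setT (fun w => edist (f w) (g w)).
Proof.
move=> mf mg; rewrite /edist.
apply: (measurableT_comp (f := @Num.sqrt R)).
  exact: continuous_measurable_fun (@sqrt_continuous R).
apply: measurable_sum => i; apply: measurable_funX; apply: measurable_funB.
- exact: (measurableT_comp (measurable_tnth i) mf).
- exact: (measurableT_comp (measurable_tnth i) mg).
Qed.

Lemma measurable_fun_match_cost n (x y : nat -> T -> d.-tuple R) (s : {perm 'I_n}) :
  (forall i : 'I_n, measurable_fun setT (x i)) ->
  (forall i : 'I_n, measurable_fun setT (y i)) ->
  measurable_fun setT (fun w => match_cost (x^~ w) (y^~ w) s).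
Proof.
by move=> mx my; apply: measurable_sum => i; exact: measurable_fun_edist.
Qed.

Lemma measurable_opt_matching n (x y : nat -> T -> d.-tuple R) (s : {perm 'I_n}) :
  (forall i : 'I_n, measurable_fun setT (x i)) ->
  (forall i : 'I_n, measurable_fun setT (y i)) ->
  measurable [set w | opt_matching (x^~ w) (y^~ w) s].
Proof.
move=> mx my.
rewrite (_ : [set _ | _] = \bigcap_(s' in [set: {perm 'I_n}])
  [set w | match_cost (x^~ w) (y^~ w) s <= match_cost (x^~ w) (y^~ w) s']).
  apply: fin_bigcap_measurable => [|s' _]; first exact: finite_finset.
  rewrite -[X in measurable X]setTI; apply: measurable_fun_le => //;
  exact: measurable_fun_match_cost.
by apply/seteqP; split=> [w h s' _|w h s']; exact: h.
Qed.

End EuclideanMeasurability.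

(** * Union bounds and Borel-Cantelli *)

Section MeasureInequalities.
Context {R : realType} {d0 : measure_display} {T : measurableType d0}.
Variable P : {measure set T -> \bar R}.
Local Open Scope ereal_scope.

Lemma measure_bigsetU_le (I : Type) (r : seq I) (p : pred I) (F : I -> set T) :
    (forall i, measurable (F i)) ->
  P (\big[setU/set0]_(i <- r | p i) F i) <= \sum_(i <- r | p i) P (F i).
Proof.
move=> mF; elim: r => [|i r IH]; first by rewrite !big_nil measure0.
rewrite !big_cons; case: ifP => // _.
apply: (le_trans (measureU2 P (mF i) _)); first exact: bigsetU_measurable.
exact: leeD2l.
Qed.

Lemma measure_bigsetU_null_inter (I : eqType) (r : seq I) (F : I -> set T) :
    uniq r -> (forall i, measurable (F i)) ->
    (forall i j, i != j -> P (F i `&` F j) = 0) ->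
  P (\big[setU/set0]_(i <- r) F i) = \sum_(i <- r) P (F i).
Proof.
move=> + mF F0; elim: r => [|i r IH]; first by rewrite !big_nil measure0.
rewrite cons_uniq => /andP[ir ur]; rewrite !big_cons.
set B := \big[setU/set0]_(j <- r) F j.
have mB : measurable B by exact: bigsetU_measurable.
have BF0 : P (B `&` F i) = 0.
  apply/eqP; rewrite -measure_le0 big_distrl /=.
  apply: (le_trans (measure_bigsetU_le _ _ _)).
    by move=> j; exact: measurableI.
  rewrite big_seq big1// => j jr; apply: F0.
  by apply: contraNneq ir => <-.
have -> : F i `|` B = F i `|` (B `\` F i).
  apply/seteqP; split=> w [Fw|]; [by left| |by left|by move=> []; right].
  by have [Fw|Fw] := pselect (F i w); [left|right].
rewrite measureU//; [|exact: measurableD|by rewrite setIC setDKI].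
rewrite -IH//; congr (_ + _); apply/esym.
by apply: (eq_trans (measureDI P mB (mF i))); rewrite [X in _ + X]BF0 adde0.
Qed.

(** Borel-Cantelli: the telescoping majorant bounds all partial sums of the probabilities by
    [u 0]. *)
Lemma ae_near_not_telescope (F : nat -> set T) (u : nat -> R) :
    (forall n, measurable (F n)) -> (forall n, (0 <= u n)%R) ->
    (forall n, P (F n) <= (u n - u n.+1)%:E) ->
  {ae P, forall w, \forall n \near \oo, ~ F n w}.
Proof.
move=> mF u0 Fu; exists (lim_sup_set F); split.
- apply: bigcap_measurable => // n _.
  by apply: bigcup_measurable => k _; exact: mF.
- apply: lim_sup_set_cvg0 => //; apply: (@le_lt_trans _ _ (u 0%N)%:E); last first.
    exact: ltry.
  apply: lime_le; first by apply: is_cvg_nneseries.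
  apply: nearW => n.
  apply: (@le_trans _ _ (\sum_(0 <= i < n) (u i - u i.+1)%:E)).
    by apply: lee_sum => i _; exact: Fu.
  rewrite sumEFin lee_fin.
  suff -> : (\sum_(0 <= i < n) (u i - u i.+1) = u 0%N - u n)%R.
    by rewrite gerBl.
  elim: n => [|n IH]; first by rewrite big_geq// subrr.
  by rewrite big_nat_recr//= IH addrA subrK.
- move=> w /= h n _; apply: contrapT => hn; apply: h.
  by exists n => // k /= nk Fk; apply: hn; exists k.
Qed.

End MeasureInequalities.

(** * The random instance *)

Section Densities.
Context {R : realType} {d0 : measure_display} {T : measurableType d0}.
Context {P : probability T R} {d : nat}.
Variables (V : T -> d.-tuple R) (phi : d.-tuple R -> R).
Hypothesis hV : has_density P V phi.

Lemma density_null (A : set (d.-tuple R)) : measurable A ->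
    (forall g : d.-tuple R -> \bar R, (forall t, 0 <= g t)%E ->
      (forall t, ~ A t -> g t = 0%E) -> leb_int g = 0%E) ->
  P (V @^-1` A) = 0%E.
Proof.
move=> mA hA; have [_ [_ [phi0 ->//]]] := hV; apply: hA.
  by move=> t; rewrite lee_fin mulr_ge0.
by move=> t At; rewrite indicE memNset// mul0r.
Qed.

Lemma density_point_null (A : set (d.-tuple R)) a : (0 < d)%N ->
  measurable A -> A `<=` [set a] -> P (V @^-1` A) = 0%E.
Proof.
move=> d1 mA Aa; apply: density_null => // g g0 gA.
by apply: (@leb_int_support1 _ _ a) => // t ta; apply: gA => /Aa.
Qed.

Lemma density_hyperboloid_null (A : set (d.-tuple R)) a b (c : R) : (2 <= d)%N ->
    a <> b -> measurable A -> A `<=` [set t | edist a t - edist b t = c] ->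
  P (V @^-1` A) = 0%E.
Proof.
move=> d2 ab mA Aab; apply: density_null => // g g0 gA.
by apply: (leb_int_hyperboloid d2 ab g0 (c := c)) => t tc; apply: gA => /Aab.
Qed.

End Densities.

Lemma measurable_set_eqr {R : realType} {d0 : measure_display}
    {T : measurableType d0} (f g : T -> R) :
    measurable_fun setT f -> measurable_fun setT g ->
  measurable [set w | f w = g w].
Proof.
move=> mf mg; rewrite (_ : [set _ | _] =
    (setT `&` [set w | f w <= g w]) `&` (setT `&` [set w | g w <= f w])).
  by apply: measurableI; exact: measurable_fun_le.
rewrite !setTI; apply/seteqP; split=> w /=; first by move=> ->.
by move=> [fg gf]; apply/le_anti/andP.
Qed.

Section Samples.
Context {R : realType} {d : nat} {d0 : measure_display} {T : measurableType d0}.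
Context {P : probability T R}.
Variables (X Y : nat -> T -> d.-tuple R) (phiP phiD : d.-tuple R -> R).
Hypotheses (hd : (2 <= d)%N)
  (hX : forall i, has_density P (X i) phiP)
  (hY : forall i, has_density P (Y i) phiD).
Let Z (k : nat + nat) : T -> d.-tuple R :=
  match k with inl i => X i | inr i => Y i end.
Hypothesis hind : mutually_independent P Z.

Let mZ k : measurable_fun setT (Z k).
Proof. by case: k => i; [case: (hX i)|case: (hY i)]. Qed.

Let hZ k : has_density P (Z k) (if k is inl _ then phiP else phiD).
Proof. by case: k. Qed.

(** The booleans separate pickups from deliveries; points of one kind share a density. *)
Let P_eqZ (A : set (d.-tuple R)) k k' : measurable A ->
  (if k is inl _ then true else false) = (if k' is inl _ then true else false) ->
  P (Z k @^-1` A) = P (Z k' @^-1` A).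
Proof.
move=> mA kk'; have [_ [_ [_ ->//]]] := hZ k; have [_ [_ [_ ->//]]] := hZ k'.
by case: k kk'; case: k'.
Qed.

Lemma sample_coincidence_null (k j : nat + nat) : k != j ->
  P.-negligible [set w | edist (Z k w) (Z j w) = 0].
Proof.
move=> kj.
pose G := g_sigma_algebraType (cylinders Z [:: k]).
pose B := [set p : G * d.-tuple R | edist (Z k p.1) p.2 = 0].
have mB : measurable B.
  apply: measurable_set_eqr => //; apply: measurable_fun_edist => //.
  by apply: measurableT_comp => //; apply: measurable_coord; rewrite inE.
apply: (indep_section_null mZ hind (s := [:: k]) (B := B)) => //.
  by rewrite /= inE kj.
move=> w; apply: (density_point_null (hZ j) (a := Z k w)).
- exact: ltnW.
- exact: measurable_xsection.
- by move=> t; rewrite /xsection /= inE => /edist_eq0 ->.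
Qed.

Lemma match_cost_tie_null n (s s' : {perm 'I_n}) : s != s' ->
  P.-negligible
    [set w | match_cost (X^~ w) (Y^~ w) s = match_cost (X^~ w) (Y^~ w) s'].
Proof.
move=> ss'.
have [i si] : exists i, s i != s' i.
  apply: contrapT => h; move/eqP: ss'; apply; apply/permP => i.
  by apply/eqP; apply: contrapT => /negP hi; apply: h; exists i.
(* All sample points except the delivery [i], which is the one left random. *)
pose r : seq (nat + nat) := map inl (iota 0 n) ++
  map inr [seq j <- iota 0 n | j != i :> nat].
have uniq_r : uniq (rcons r (inr (i : nat))).
  rewrite rcons_uniq mem_cat negb_or cat_uniq.
  rewrite !map_inj_uniq ?filter_uniq ?iota_uniq ?andbT//=; try by move=> ? ? [].
  rewrite mem_map; last by move=> ? ? [].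
  rewrite mem_filter eqxx andbT; apply/andP; split.
    by apply/mapP => -[].
  by apply/hasP => -[_ /mapP[a _ ->] /mapP[]].
have Xr (j : 'I_n) : @inl nat nat j \in r.
  by rewrite mem_cat map_f// mem_iota add0n ltn_ord.
have Yr (j : 'I_n) : j != i -> @inr nat nat j \in r.
  by move=> ji; rewrite mem_cat orbC map_f// mem_filter ji mem_iota add0n ltn_ord.
pose G := g_sigma_algebraType (cylinders Z r).
have mXG (j : 'I_n) : measurable_fun setT (X j : G -> _).
  exact: (@measurable_coord _ _ _ _ Z r (inl (j : nat))).
have mYG (j : 'I_n) : j != i -> measurable_fun setT (Y j : G -> _).
  by move=> ji; apply: (@measurable_coord _ _ _ _ Z r (inr (j : nat))); exact: Yr.
(* The part of the tie equation free of [Y i], moved to the right-hand side. *)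
pose c (w : G) : R := \sum_(j < n) if j == i then 0 else
  edist (X (s' j) w) (Y j w) - edist (X (s j) w) (Y j w).
have mc : measurable_fun setT c.
  apply: measurable_sum => j; case: eqP => [_|/eqP ji]; first exact: measurable_cst.
  by apply: measurable_funB; apply: measurable_fun_edist => //; exact: mYG.
(* Coinciding foci are excluded from [B], so each of its sections is empty or within one branch;
   [C0] treats the coincidence. *)
pose B := [set p : G * d.-tuple R |
    edist (X (s i) p.1) p.2 - edist (X (s' i) p.1) p.2 = c p.1] `&`
  ~` [set p : G * d.-tuple R | edist (X (s i) p.1) (X (s' i) p.1) = 0].
have mXB (j : 'I_n) : measurable_fun setT (fun p : G * d.-tuple R => X j p.1).
  exact: (measurableT_comp (mXG j)).
have mB : measurable B.
  apply: measurableI; [|apply: measurableC]; apply: measurable_set_eqr => //.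
  - by apply: measurable_funB; exact: measurable_fun_edist.
  - exact: (measurableT_comp mc).
  - exact: measurable_fun_edist.
have B0 : P.-negligible [set w | B (w, Z (inr (i : nat)) w)].
  apply: (indep_section_null mZ hind uniq_r mB) => w.
  have [e|e] := eqVneq (edist (X (s i) w) (X (s' i) w)) 0.
    rewrite (_ : _ @^-1` _ = set0) ?measure0//.
    by apply/seteqP; split=> // t; rewrite /xsection /= inE => -[_ /(_ e)].
  apply: (density_hyperboloid_null (hZ _) (a := X (s i) w) (b := X (s' i) w)
    (c := c w)) => //.
  - by move=> e'; move: e; rewrite e' edistxx eqxx.
  - exact: measurable_xsection.
  - by move=> t; rewrite /xsection /= inE => -[].
have C0 : P.-negligible [set w | edist (X (s i) w) (X (s' i) w) = 0].
  by apply: (@sample_coincidence_null (inl (s i : nat)) (inl (s' i : nat))).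
apply: negligibleS (negligibleU B0 C0) => w /= tie.
have [e|e] := pselect (edist (X (s i) w) (X (s' i) w) = 0); [by right|left].
have cE : c w = \sum_(j < n | j != i) edist (X (s' j) w) (Y j w) -
    \sum_(j < n | j != i) edist (X (s j) w) (Y j w).
  rewrite /c (bigD1 i)//= eqxx add0r -sumrB.
  by apply: eq_bigr => j /negbTE ->.
split=> //=; rewrite cE; move: tie.
by rewrite /match_cost (bigD1 i)//= [X in _ = X -> _](bigD1 i)//=; lra.
Qed.

(** Rectangles have product probabilities before and after reindexing, with equal factors because
    [f] is injective on [r] and preserves kinds. *)
Lemma sample_law_reindex (r : seq (nat + nat)) (f g : nat + nat -> nat + nat) :
    uniq r -> {in r, cancel f g} ->
    (forall k, (if f k is inl _ then true else false) =
               (if k is inl _ then true else false)) ->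
  forall B : set (nat + nat -> d.-tuple R), <<s cylinders coordinate r >> B ->
    P ((fun w k => Z (f k) w) @^-1` B) = P ((fun w k => Z k w) @^-1` B).
Proof.
move=> ur fK fl; apply: eq_law => // A mA.
rewrite !bigcap_seq hind//.
have -> : \big[setI/setT]_(k <- r) (Z (f k) @^-1` A k) =
    \big[setI/setT]_(k <- map f r) (Z k @^-1` A (g k)).
  by rewrite big_map !big_seq; apply: eq_bigr => k kr; rewrite fK.
rewrite hind//; last by rewrite map_inj_in_uniq//; exact: can_in_inj fK.
rewrite big_map !big_seq; apply: eq_bigr => k kr.
by rewrite fK//; exact: P_eqZ.
Qed.

Let mX i : measurable_fun setT (X i). Proof. exact: (mZ (inl i)). Qed.
Let mY i : measurable_fun setT (Y i). Proof. exact: (mZ (inr i)). Qed.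

Let mO n (s : {perm 'I_n}) : measurable [set w | opt_matching (X^~ w) (Y^~ w) s].
Proof. by apply: measurable_opt_matching. Qed.

(* relabelling the pickups by [s] turns [s] into the identity matching *)
Lemma prob_opt_matching_eq n (s : {perm 'I_n}) :
  P [set w | opt_matching (X^~ w) (Y^~ w) s] =
  P [set w | opt_matching (X^~ w) (Y^~ w) (1%g : {perm 'I_n})].
Proof.
pose r : seq (nat + nat) := map inl (iota 0 n) ++ map inr (iota 0 n).
pose f (u : {perm 'I_n}) (k : nat + nat) : nat + nat :=
  match k with
  | inl i => inl (if insub i is Some j then u j : nat else i)
  | inr i => inr i
  end.
have ur : uniq r.
  rewrite cat_uniq !map_inj_uniq ?iota_uniq//=; try by move=> ? ? [].
  by rewrite andbT; apply/hasP => -[_ /mapP[a _ ->] /mapP[]].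
have fK : {in r, cancel (f s) (f s^-1%g)}.
  move=> k; rewrite mem_cat => /orP[] /mapP[i + ->]//=.
  rewrite mem_iota add0n /= => ni.
  have -> : insub i = Some (Ordinal ni) by rewrite insubT.
  by rewrite /= valK permK.
pose B := [set h : nat + nat -> d.-tuple R |
  opt_matching (fun i => h (inl i)) (fun i => h (inr i)) (1%g : {perm 'I_n})].
have mB : <<s cylinders coordinate r >> B.
  apply: (@measurable_opt_matching R d _
    (g_sigma_algebraType (cylinders (@coordinate _ (d.-tuple R) _) r)) n
    (fun i h => h (inl i)) (fun i h => h (inr i))).
  - move=> i; apply: (@measurable_coord _ _ _ _ coordinate r (inl (i : nat))).
    by rewrite mem_cat map_f// mem_iota add0n ltn_ord.
  - move=> i; apply: (@measurable_coord _ _ _ _ coordinate r (inr (i : nat))).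
    by rewrite mem_cat orbC map_f// mem_iota add0n ltn_ord.
have -> : [set w | opt_matching (X^~ w) (Y^~ w) s] =
    (fun w k => Z (f s k) w) @^-1` B.
  (* After relabelling, [u] costs what [u * s] did, and [u * s] ranges over all permutations. *)
  have mcE w u : match_cost (fun i => Z (f s (inl i)) w)
      (fun i => Z (f s (inr i)) w) u = match_cost (X^~ w) (Y^~ w) (u * s)%g.
    apply: eq_bigr => i _; rewrite permM /= valK //.
  apply/seteqP; split=> w /= h u.
  - by rewrite !mcE mul1g.
  - by have := h (u * s^-1)%g; rewrite !mcE mul1g mulgKV.
by rewrite (sample_law_reindex ur fK)// => -[].
Qed.

(** There are [n!] such events, equally likely and overlapping only in null sets. *)
Lemma prob_opt_matching_le n (s : {perm 'I_n}) :
  (P [set w | opt_matching (X^~ w) (Y^~ w) s] <= (n`!%:R^-1)%:E)%E.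
Proof.
pose O (s : {perm 'I_n}) := [set w | opt_matching (X^~ w) (Y^~ w) s].
rewrite -/(O s); have : (\sum_(u : {perm 'I_n}) P (O u) <= 1)%E.
  rewrite -measure_bigsetU_null_inter//.
  - by apply: probability_le1; apply: bigsetU_measurable => u _; exact: mO.
  - exact: index_enum_uniq.
  - by move=> u; exact: mO.
  - move=> u v uv; apply: measure_negligible.
      by apply: measurableI; exact: mO.
    apply: negligibleS (match_cost_tie_null uv) => w [/= Ou Ov].
    by apply/le_anti/andP.
rewrite (eq_bigr (fun=> P (O s))) => [|u _]; last first.
  by rewrite /O prob_opt_matching_eq [RHS]prob_opt_matching_eq.
rewrite -[P (O s)]fineK ?fin_num_measure//; last exact: mO.
rewrite sumEFin !lee_fin sumr_const card_Sn => h.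
by rewrite -[leRHS]mul1r ler_pdivlMr ?ltr0n ?fact_gt0// mulr_natr.
Qed.

(** Markov's inequality for [2 ^ N]. The union covers every optimal matching that SPLICE may
    select. *)
Lemma prob_many_cycles_le n :
  (P (\big[setU/set0]_(s : {perm 'I_n} | n.+1 ^ 3 <= 2 ^ #|porbits s|)
       [set w | opt_matching (X^~ w) (Y^~ w) s])%N <=
   ((n.+1%:R ^+ 2)^-1)%:E)%E.
Proof.
apply: (le_trans (measure_bigsetU_le _ _ _ _)); first by move=> s; exact: mO.
apply: (@le_trans _ _ (\sum_(s : {perm 'I_n})
    ((2 ^ #|porbits s|)%:R / (n.+1%:R ^+ 3 * n`!%:R))%:E)%E).
  rewrite big_mkcond; apply: lee_sum => s _; case: ifPn => hs; last first.
    by rewrite lee_fin mulr_ge0// invr_ge0 mulr_ge0// exprn_ge0.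
  apply: (le_trans (prob_opt_matching_le s)); rewrite lee_fin invfM mulrA.
  rewrite ler_peMl ?invr_ge0// ler_pdivlMr ?exprn_gt0 ?ltr0n// mul1r.
  by rewrite -natrX ler_nat.
rewrite sumEFin lee_fin -mulr_suml -natr_sum.
rewrite ler_pdivrMr ?mulr_gt0 ?exprn_gt0 ?ltr0n ?fact_gt0//.
rewrite (exprSr _ 2) -(mulrA _ _ n`!%:R) mulKf ?expf_neq0 ?pnatr_eq0//.
rewrite -natrM -factS ler_nat.
exact: sum_exp_porbits.
Qed.

(** * Linear growth: few pairs are close *)

Let close (e : R) i := [set w | edist (X i w) (Y i w) <= e].

Let m_close e i : measurable (close e i).
Proof.
by rewrite -[X in measurable X]setTI; apply: measurable_fun_le => //;
  exact: measurable_fun_edist.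
Qed.

Let prob_close_eq e i : P (close e i) = P (close e 0%N).
Proof.
pose r : seq (nat + nat) := [:: inl 0%N; inr 0%N].
pose B := [set h : nat + nat -> d.-tuple R | edist (h (inl 0%N)) (h (inr 0%N)) <= e].
have mB : <<s cylinders coordinate r >> B.
  have : @measurable _ (g_sigma_algebraType
      (cylinders (@coordinate _ (d.-tuple R) _) r)) (setT `&` B).
    apply: measurable_fun_le => //; apply: measurable_fun_edist.
    - by apply: (@measurable_coord _ _ _ _ coordinate r (inl 0%N)).
    - by apply: (@measurable_coord _ _ _ _ coordinate r (inr 0%N)).
  by rewrite setTI.
pose f (k : nat + nat) : nat + nat :=
  match k with inl _ => inl i | inr _ => inr i end.
pose g (k : nat + nat) : nat + nat :=
  match k with inl _ => inl 0%N | inr _ => inr 0%N end.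
have fK : {in r, cancel f g} by move=> k; rewrite !inE => /orP[]/eqP ->.
by apply: (sample_law_reindex _ fK _ mB) => // -[].
Qed.

(** Continuity from above along [1 / (k + 1)]: the limiting event is the null coincidence of [X 0]
    and [Y 0]. Equal laws make the choice uniform in [i]. *)
Lemma exists_prob_close_le (eps : R) : 0 < eps ->
  exists2 e : R, 0 < e & forall i, (P (close e i) <= eps%:E)%E.
Proof.
move=> eps0; pose F k := close k.+1%:R^-1 0%N.
have F0 : P (\bigcap_k F k) = 0%E.
  apply: measure_negligible; first by apply: bigcapT_measurable => k; exact: m_close.
  have := @sample_coincidence_null (inl 0%N) (inr 0%N) isT.
  apply: negligibleS => w /= Fw; apply/eqP; rewrite eq_le edist_ge0 andbT.
  rewrite leNgt; apply/negP => /ltr_add_invr[k]; rewrite add0r.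
  by rewrite ltNge (Fw k).
have : P \o F @ \oo --> 0%E.
  rewrite -F0; apply: nonincreasing_cvg_mu.
  - exact: (le_lt_trans (probability_le1 P (m_close _ _)) (ltry _)).
  - by move=> k; exact: m_close.
  - by apply: bigcapT_measurable => k; exact: m_close.
  - move=> k l kl; apply/subsetPset => w /= h; apply: (le_trans h).
    by rewrite lef_pV2 ?posrE ?ltr0n// ler_nat.
move=> /fine_cvgP[_] /cvgrPdist_le/(_ _ eps0)[k _ /(_ k (leqnn k))] /=.
rewrite sub0r normrN ger0_norm ?fine_ge0// => Fk.
exists k.+1%:R^-1; first by rewrite invr_gt0.
move=> i; rewrite prob_close_eq -lee_fin fineK// in Fk *.
by rewrite fin_num_measure//; exact: m_close.
Qed.

Let prob_bigI_close_le e (p : R) (r : seq nat) : uniq r ->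
  (forall i, P (close e i) <= p%:E)%E ->
  (P (\big[setI/setT]_(i <- r) close e i) <= (p ^+ size r)%:E)%E.
Proof.
move=> + hp; elim: r => [|i r IH]; first by rewrite big_nil probability_setT.
rewrite cons_uniq => /andP[ir ur]; rewrite big_cons /= exprS EFinM.
apply: (@le_trans _ _ (P (close e i) * P (\big[setI/setT]_(j <- r) close e j))%E);
  last by apply: lee_pmul => //; exact: IH.
pose r1 : seq (nat + nat) := [:: inl i; inr i].
pose r2 : seq (nat + nat) := map inl r ++ map inr r.
have m_cyl (q : seq (nat + nat)) j : inl j \in q -> inr j \in q ->
    <<s cylinders Z q >> (close e j).
  move=> lq rq; have : @measurable _ (g_sigma_algebraType (cylinders Z q))
      (setT `&` close e j).
    apply: measurable_fun_le => //; apply: measurable_fun_edist.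
    - exact: (@measurable_coord _ _ _ _ Z q (inl j)).
    - exact: (@measurable_coord _ _ _ _ Z q (inr j)).
  by rewrite setTI.
rewrite le_eqVlt; apply/orP; left; apply/eqP.
apply: (indep_cylinders mZ hind (s1 := r1) (s2 := r2)).
- rewrite cat_uniq [uniq r1]/= cat_uniq !map_inj_uniq//; try by move=> ? ? [].
  rewrite ur andTb andTb andbT; apply/andP; split.
    apply/hasP => -[k]; rewrite mem_cat !inE => /orP[]/mapP[j jr ->] /orP[]/eqP//.
    + by case=> ji; rewrite -ji jr in ir.
    + by case=> ji; rewrite -ji jr in ir.
  by apply/hasP => -[_ /mapP[a _ ->] /mapP[]].
- by apply: m_cyl; rewrite !inE eqxx ?orbT.
- rewrite big_seq.
  apply: (@bigsetI_measurable _ (g_sigma_algebraType (cylinders Z r2))) => j jr.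
  by apply: m_cyl; rewrite mem_cat map_f ?orbT.
Qed.

Lemma prob_many_close_le e n : (forall i, P (close e i) <= (16^-1)%:E)%E ->
  (P (\big[setU/set0]_(A : {set 'I_n} | (n <= 2 * #|A|)%N)
       \big[setI/setT]_(i in A) close e i) <= (2^-1 ^+ n)%:E)%E.
Proof.
move=> pe; apply: (le_trans (measure_bigsetU_le _ _ _ _)).
  by move=> A; apply: bigsetI_measurable => i _; exact: m_close.
apply: (@le_trans _ _ (\sum_(A : {set 'I_n}) (4^-1 ^+ n)%:E)%E).
  rewrite big_mkcond; apply: lee_sum => A _; case: ifPn => hA; last first.
    by rewrite lee_fin exprn_ge0.
  have -> : \big[setI/setT]_(i in A) close e i =
      \big[setI/setT]_(i <- map val (enum A)) close e i.
    by rewrite big_map big_enum.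
  have uA : uniq (map val (enum A)).
    by rewrite map_inj_uniq ?enum_uniq//; exact: val_inj.
  apply: (le_trans (prob_bigI_close_le uA pe)); rewrite size_map -cardE lee_fin.
  (* The exponent becomes [2 * #|A|], which is at least [n]. *)
  have -> : 16^-1 = 4^-1 ^+ 2 :> R by rewrite exprVn; congr _^-1; ring.
  rewrite -exprM; apply: ler_wiXn2l => //.
    by rewrite invf_le1 ?ler1n.
rewrite sumEFin lee_fin sumr_const.
have -> : #|{set 'I_n}| = (2 ^ n)%N.
  by rewrite -cardsT -powersetT card_powerset cardsT card_ord.
rewrite -[leLHS]mulr_natl natrX -exprMn.
by have -> : 2%:R * 4^-1 = 2^-1 :> R by field.
Qed.

End Samples.

(** * The limit *)

Lemma sum_ge_of_few_small {R : realType} n (f : 'I_n -> R) (e : R) : 0 <= e ->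
    (forall i, 0 <= f i) -> (2 * #|[set i | (f i <= e)%R]%SET| < n)%N ->
  e * n%:R / 2 <= \sum_(i < n) f i.
Proof.
move=> e0 f0 An; set A := finset _ in An.
apply: (@le_trans _ _ (\sum_(i in ~: A) e)).
  rewrite sumr_const -[leRHS]mulr_natr -mulrA ler_wpM2l//.
  rewrite ler_pdivrMr// -natrM ler_nat.
  by have := cardsC A; rewrite card_ord; lia.
rewrite [leLHS]big_mkcond; apply: ler_sum => i _; case: ifPn => // iA.
by apply/ltW; move: iA; rewrite !inE -ltNge.
Qed.

Lemma cvg_ratio_of_sqrt_error {R : realType} (Lo Ls : nat -> R) (D e : R) :
    0 <= D -> 0 < e ->
    (\forall n \near \oo, e * n%:R / 2 <= Lo n /\
      exists2 N : nat, (N ^ 2 <= 36 * n.+1)%N & `|Ls n - Lo n| <= D *+ (2 * N)) ->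
  (Ls n / Lo n) @[n --> \oo] --> (1 : R).
Proof.
move=> D0 e0 H; apply/cvgrPdist_le => eps eps0.
(* Since [N ^ 2 <= 72 n], the error squared is at most [288 D ^ 2 n]; this is below
   [(eps e n / 2) ^ 2] once [n] exceeds this threshold. *)
have := nbhs_infty_ger (1152 * D ^+ 2 / (eps * e) ^+ 2).
have := nbhs_infty_gt 0%N.
apply: filter_app2; apply: filterS H => n [Ln [N Nn hN]] n0 hn.
have n0' : 0 < n%:R :> R by rewrite ltr0n.
have L0 : 0 < Lo n by apply: lt_le_trans Ln; rewrite divr_gt0// mulr_gt0.
have -> : 1 - Ls n / Lo n = (Lo n - Ls n) / Lo n.
  by rewrite mulrBl divff// gt_eqF.
rewrite normrM normfV (gtr0_norm L0) ler_pdivrMr// distrC.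
apply: (le_trans hN).
apply: (@le_trans _ _ (eps * (e * n%:R / 2))); last by rewrite ler_pM2l.
have ee : 0 < (eps * e) ^+ 2 by rewrite exprn_gt0// mulr_gt0.
rewrite ler_pdivrMr// in hn.
have N2 : (N%:R ^+ 2 <= 72 * n%:R :> R).
  by rewrite -natrX -natrM ler_nat; move: Nn n0; lia.
rewrite -[leLHS]mulr_natr natrM.
rewrite -(@ler_pXn2r _ 2)// ?nnegrE; last 2 first.
- by rewrite mulr_ge0// mulr_ge0.
- by apply/ltW; rewrite mulr_gt0// divr_gt0// mulr_gt0.
have h1 : D ^+ 2 * N%:R ^+ 2 <= D ^+ 2 * (72 * n%:R).
  by rewrite ler_wpM2l// sqr_ge0.
have h2 : 1152 * D ^+ 2 * n%:R <= n%:R * (eps * e) ^+ 2 * n%:R.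
  by rewrite ler_wpM2r// ltW.
have -> : (D * (2 * N%:R)) ^+ 2 = 4 * (D ^+ 2 * N%:R ^+ 2) by ring.
have -> : (eps * (e * n%:R / 2)) ^+ 2 = (n%:R * (eps * e) ^+ 2 * n%:R) / 4 by field.
lra.
Qed.

Lemma compact_edist_bounded {R : realType} (d : nat) (Omega : set (d.-tuple R)) :
    compact (@tuple_row R d @` Omega) ->
  exists2 D : R, 0 <= D & forall a b, Omega a -> Omega b -> edist a b <= D.
Proof.
move=> /compact_bounded[M [_ hM]].
(* The norm bound is available only for reals strictly above [M]. *)
pose K := M + 1.
have hK t i : Omega t -> `|tnth t i| <= K.
  move=> Ot; have MK : M < K by rewrite ltrDl.
  have /= := hM K MK (tuple_row t) (ex_intro2 _ _ t Ot erefl).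
  rewrite [`|tuple_row t|]mx_normrE => /(le_trans _); apply.
  have := le_bigmax 0 (fun ij => `|tuple_row t ij.1 ij.2|) (ord0, i).
  by rewrite /= mxE.
exists (Num.sqrt (\sum_(i < d) (2 * K) ^+ 2)); first exact: sqrtr_ge0.
move=> a b Oa Ob; apply: ler_wsqrtr; apply: ler_sum => i _.
rewrite -[leLHS]real_normK ?num_real//.
have K0 : 0 <= K by apply: le_trans (hK a i Oa).
rewrite ler_pXn2r// ?nnegrE ?mulr_ge0//.
have := hK a i Oa; have := hK b i Ob; have := ler_normB (tnth a i) (tnth b i).
lra.
Qed.

Unset Implicit Arguments.

Theorem theorem1 (R : realType) (d : nat) (hd : (2 <= d)%N)
  (Omega : set (d.-tuple R)) (hOmega : compact (@tuple_row R d @` Omega))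
  (d0 : measure_display) (T : measurableType d0) (P : probability T R)
  (X Y : nat -> T -> d.-tuple R) (phiP phiD : d.-tuple R -> R)
  (hX : forall i, has_density P (X i) phiP)
  (hY : forall i, has_density P (Y i) phiD)
  (hXO : forall i, {ae P, forall w, Omega (X i w)})
  (hYO : forall i, {ae P, forall w, Omega (Y i w)})
  (hind : mutually_independent P
            (fun k : nat + nat => match k with inl i => X i | inr i => Y i end))
  (Lopt Lspl : nat -> T -> R)
  (hLopt : forall n w, is_opt_tour_len n (X^~ w) (Y^~ w) (Lopt n w))
  (hLspl : forall n w, is_splice_len n (X^~ w) (Y^~ w) (Lspl n w)) :
  {ae P, forall w, (Lspl n w / Lopt n w) @[n --> \oo] --> (1 : R)}.
Proof.
have [D D0 hD] := compact_edist_bounded hOmega.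
have p16 : 0 < 16^-1 :> R by rewrite invr_gt0.
have [e e0 he] := exists_prob_close_le hd hX hY hind p16.
have mX i : measurable_fun setT (X i) by have [] := hX i.
have mY i : measurable_fun setT (Y i) by have [] := hY i.
have few_cycles : {ae P, forall w, \forall n \near \oo,
    ~ (\big[setU/set0]_(s : {perm 'I_n} | (n.+1 ^ 3 <= 2 ^ #|porbits s|)%N)
       [set w | opt_matching (X^~ w) (Y^~ w) s]) w}.
  (* The increments [2 / ((n + 1) (n + 2))] dominate [1 / (n + 1) ^ 2], because
     [n + 2 <= 2 (n + 1)]. *)
  apply: (ae_near_not_telescope (u := fun n => 2 / n.+1%:R)) => n.
  - by apply: bigsetU_measurable => s _; exact: measurable_opt_matching.
  - by rewrite divr_ge0.
  apply: (le_trans (prob_many_cycles_le hd hX hY hind n)); rewrite lee_fin.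
  have n1 : n.+1%:R != 0 :> R by rewrite pnatr_eq0.
  have n2 : n.+2%:R != 0 :> R by rewrite pnatr_eq0.
  have -> : 2 / n.+1%:R - 2 / n.+2%:R = 2 / (n.+1%:R * n.+2%:R) :> R.
    by rewrite -(natr1 n.+1) in n2 *; field; exact/andP.
  rewrite expr2 -[leLHS]div1r ler_pdivrMr ?mulr_gt0 ?ltr0n//.
  rewrite mulrAC ler_pdivlMr ?mulr_gt0 ?ltr0n// -!natrM mul1r ler_nat.
  by rewrite mulnCA leq_mul2l /=; lia.
have few_close : {ae P, forall w, \forall n \near \oo,
    ~ (\big[setU/set0]_(A : {set 'I_n} | (n <= 2 * #|A|)%N)
       \big[setI/setT]_(i in A) [set w | edist (X i w) (Y i w) <= e]) w}.
  apply: (ae_near_not_telescope (u := fun n => 2 * 2^-1 ^+ n)) => n.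
  - apply: bigsetU_measurable => A _; apply: bigsetI_measurable => i _.
    rewrite -[X in measurable X]setTI; apply: measurable_fun_le => //.
    exact: measurable_fun_edist.
  - by rewrite mulr_ge0// exprn_ge0.
  apply: (le_trans (prob_many_close_le hX hY hind n he)); rewrite lee_fin.
  by rewrite exprS mulrA divff// mul1r; lra.
have {}hXO := ae_foralln hXO; have {}hYO := ae_foralln hYO.
have aeP : Filter (almost_everywhere P) by exact: ae_filter_ringOfSetsType.
apply: filterS3 hXO hYO (filterI few_cycles few_close) => w Xw Yw [cycles_w close_w].
apply: (cvg_ratio_of_sqrt_error D0 e0).
apply: filterS2 cycles_w close_w => n cycles_n close_n.
have xyD (i j : 'I_n) : edist (X i w) (Y j w) <= D by exact: hD.
have [Lo_ge [s s_opt dist_le]] := splice_opt_dist D0 xyD (hLopt n w) (hLspl n w).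
split; last first.
  exists #|porbits s| => //; apply: exp2_lt_cube; rewrite ltnNge; apply/negP => hs.
  by apply: cycles_n; rewrite (bigD1 s)//=; left.
apply: le_trans Lo_ge.
apply: sum_ge_of_few_small => [|i|]; [exact: ltW|exact: edist_ge0|].
rewrite ltnNge; apply/negP => hA; apply: close_n.
(* The set of all close pairs is itself a member of the union defining the excluded event. *)
rewrite (bigD1 [set i : 'I_n | (edist (X i w) (Y i w) <= e)%R]%SET)//=; left.
by apply: (big_ind (fun S : set T => S w)) => // i; rewrite inE.
Qed.
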